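(* Let $V=\mathbb{F}_2^{10}$ with coordinate ring $\mathbb{F}_2[V]=\mathbb{F}_2[x_{ij}\mid 1\le i<j\le 5]$ and the action of the symmetric group $\mathcal{S}_5$ described in the context. Then the following invariants form a separating set for $\mathbb{F}_2[V]^{\mathcal{S}_5}$ of the smallest possible size: \begin{align*} &g_1=o(x_{12}),\\ &g_2=o(x_{12}x_{13}),\\ &g_3=o(x_{12}x_{34})+o(x_{12}x_{13}x_{24}x_{34}),\\ &g_4=o(x_{12}x_{13}x_{14})+o(x_{12}x_{13}x_{24}x_{34}),\\ &g_5=o(x_{12}x_{13}x_{23})+o(x_{12}x_{13}x_{24}x_{34}),\\ &g_6=o(x_{12}x_{13}x_{14}x_{15})+o(x_{14}x_{15}x_{24}x_{25}x_{34}x_{35}). \end{align*} In particular, $\beta_{\rm sep}(\mathbb{F}_2[V]^{\mathcal{S}_5})\le 6$.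
   Context: The group $\mathcal{S}_5$ acts on the two-element subsets of $\{1,\ldots,5\}$ by $\sigma\cdot\{i,j\}=\{\sigma(i),\sigma(j)\}$. This gives a permutation representation $V=\mathbb{F}_2^{10}$, with coordinates indexed by the two-element subsets, and $\mathcal{S}_5$ acts on $\mathbb{F}_2[V]=\mathbb{F}_2[x_{ij}\mid 1\le i<j\le 5]$ by algebra automorphisms permuting the variables, $\sigma\cdot x_{\{i,j\}}=x_{\{\sigma(i),\sigma(j)\}}$ with $x_{ij}=x_{\{i,j\}}$. (Points of $V$ correspond to simple graphs on 5 vertices, orbits to isomorphism classes.) $\mathbb{F}_2[V]^{\mathcal{S}_5}$ is the ring of invariant polynomials. For $f\in\mathbb{F}_2[V]$, $o(f)$ denotes the sum of the (distinct) elements of the $\mathcal{S}_5$-orbit of $f$. Elements $u,v\in V$ are separated by a set $S$ of invariants if $f(u)\ne f(v)$ for some $f\in S$. A subset $S$ of the invariant ring is separating if any $u,v\in V$ that can be separated by the whole invariant ring can also be separated by $S$. $\beta_{\rm sep}(\mathbb{F}_2[V]^{\mathcal{S}_5})$ is the minimal integer $\beta$ such that the set of all homogeneous invariants of degree $\le\beta$ is separating. *)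

(* Defs.v *)
From HB Require Import structures.
From mathcomp Require Import all_boot all_order all_fingroup all_algebra.
From mathcomp.multinomials Require Import mpoly.
Set Implicit Arguments.
Unset Strict Implicit.
Unset Printing Implicit Defensive.
Import GRing.Theory.
Local Open Scope ring_scope.

Notation edge := {e : {set 'I_5} | #|e| == 2%N}.

Fact mk_edge_proof (i j : 'I_5) (neq_ij : i != j) : #|[set i; j]| == 2%N.
Proof. by rewrite cards2 neq_ij. Qed.

Definition mk_edge (i j : 'I_5) (neq_ij : i != j) : edge :=
  exist _ [set i; j] (mk_edge_proof neq_ij).

Fact edge_act_proof (s : 'S_5) (e : edge) : #|s @: val e| == 2%N.
Proof. by rewrite card_imset ?(valP e) //; apply: perm_inj. Qed.

Definition edge_act (s : 'S_5) (e : edge) : edge :=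
  exist _ (s @: val e) (edge_act_proof s e).

Definition V := {ffun edge -> 'F_2}.

(* mpoly indexes its variables by ordinals, so edges are numbered by
   enum_rank. *)
Definition coord_ring := {mpoly 'F_2[#|{: edge}|]}.

Definition evar (e : edge) : coord_ring := 'X_(enum_rank e).

Definition eval (f : coord_ring) (v : V) : 'F_2 :=
  f.@[fun k => v (enum_val k)].

(* The algebra automorphism of the coordinate ring sending each variable
   x_e to x_(s e). *)
Definition poly_act (s : 'S_5) (f : coord_ring) : coord_ring :=
  comp_mpoly [tuple evar (edge_act s (enum_val k)) | k < #|{: edge}|] f.

Definition invariant (f : coord_ring) : Prop :=
  forall s : 'S_5, poly_act s f = f.

(* undup: each element of the orbit is summed only once. *)
Definition o (f : coord_ring) : coord_ring :=
  \sum_(h <- undup [seq poly_act s f | s : 'S_5]) h.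

Definition separated_by (S : coord_ring -> Prop) (u v : V) : Prop :=
  exists2 f, S f & eval f u <> eval f v.

Definition separating (S : coord_ring -> Prop) : Prop :=
  (forall f, S f -> invariant f) /\
  (forall u v : V, separated_by invariant u v -> separated_by S u v).

Definition homog_invariants_upto (b : nat) (f : coord_ring) : Prop :=
  invariant f /\ exists2 d : nat, (d <= b)%N & f \is d.-homog.

Definition is_beta_sep (b : nat) : Prop :=
  separating (homog_invariants_upto b) /\
  (forall b', separating (homog_invariants_upto b') -> (b <= b')%N).

Definition v1 : 'I_5 := @Ordinal 5 0 isT.
Definition v2 : 'I_5 := @Ordinal 5 1 isT.
Definition v3 : 'I_5 := @Ordinal 5 2 isT.
Definition v4 : 'I_5 := @Ordinal 5 3 isT.
Definition v5 : 'I_5 := @Ordinal 5 4 isT.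

Definition x12 := evar (@mk_edge v1 v2 isT).
Definition x13 := evar (@mk_edge v1 v3 isT).
Definition x14 := evar (@mk_edge v1 v4 isT).
Definition x15 := evar (@mk_edge v1 v5 isT).
Definition x23 := evar (@mk_edge v2 v3 isT).
Definition x24 := evar (@mk_edge v2 v4 isT).
Definition x25 := evar (@mk_edge v2 v5 isT).
Definition x34 := evar (@mk_edge v3 v4 isT).
Definition x35 := evar (@mk_edge v3 v5 isT).

Definition g1 := o x12.
Definition g2 := o (x12 * x13).
Definition g3 := o (x12 * x34) + o (x12 * x13 * x24 * x34).
Definition g4 := o (x12 * x13 * x14) + o (x12 * x13 * x24 * x34).
Definition g5 := o (x12 * x13 * x23) + o (x12 * x13 * x24 * x34).
Definition g6 :=
  o (x12 * x13 * x14 * x15) + o (x14 * x15 * x24 * x25 * x34 * x35).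

(* Main.v *)
(* A graph on 5 vertices is determined up to isomorphism by the values of
   g1, ..., g6: there are 34 isomorphism classes, a complete list of
   representatives is certified by closing it under adding an edge, and modulo 2
   the value of o(x_E) at a graph G counts the copies of E contained in G, so
   that the 34 value vectors can be computed and compared.  Every finite set of
   separating polynomials embeds the 34 classes in a power of F_2, hence has at
   least 6 elements because 2^5 < 34.  The summands of the g's are homogeneous
   invariants of degree at most 6, which bounds beta_sep. *)
Require Import Defs.
From Stdlib Require Import Classical_Prop.
From mathcomp Require Import all_boot all_order all_fingroup all_algebra.
From mathcomp.multinomials Require Import mpoly.
Set Implicit Arguments.
Unset Strict Implicit.
Unset Printing Implicit Defensive.
Import GRing.Theory Defs.
Local Open Scope ring_scope.

(** * The action on polynomials, and evaluation at graphs *)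

Lemma edge_actM (s t : 'S_5) (e : edge) :
  edge_act (s * t)%g e = edge_act t (edge_act s e).
Proof.
apply/val_inj; rewrite /= -imset_comp; apply: eq_imset => i /=.
by rewrite permM.
Qed.

Lemma poly_act_evar (s : 'S_5) (e : edge) :
  poly_act s (evar e) = evar (edge_act s e).
Proof.
by rewrite /poly_act /evar comp_mpolyXU -tnth_nth tnth_mktuple enum_rankK.
Qed.

Lemma poly_act_prod (s : 'S_5) (I : Type) (r : seq I) (F : I -> coord_ring) :
  poly_act s (\prod_(i <- r) F i) = \prod_(i <- r) poly_act s (F i).
Proof. exact: rmorph_prod. Qed.

Lemma poly_act_sum (s : 'S_5) (I : Type) (r : seq I) (F : I -> coord_ring) :
  poly_act s (\sum_(i <- r) F i) = \sum_(i <- r) poly_act s (F i).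
Proof. exact: raddf_sum. Qed.

(** The product [s * t] of permutations applies [s] first, so this is a right action. Expanding [f]
    into monomials reduces the claim to variables. *)
Lemma poly_actM (s t : 'S_5) (f : coord_ring) :
  poly_act (s * t)%g f = poly_act t (poly_act s f).
Proof.
rewrite /poly_act [f \mPo _]comp_mpolyE [(f \mPo _) in RHS]comp_mpolyE raddf_sum.
apply: eq_bigr => m _ /=; rewrite comp_mpolyZ rmorph_prod; congr (_ *: _).
apply: eq_bigr => i _ /=; rewrite rmorphXn /= !tnth_mktuple edge_actM.
by rewrite -poly_act_evar.
Qed.

Lemma poly_act1 (f : coord_ring) : poly_act 1%g f = f.
Proof.
rewrite -[RHS]comp_mpoly_id /poly_act; congr (comp_mpoly _ f).
apply: eq_mktuple => k; rewrite /evar; congr ('X_ _).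
rewrite -[RHS]enum_valK; congr enum_rank; apply/val_inj => /=.
rewrite -[RHS]imset_id; apply: eq_imset => i; exact: perm1.
Qed.

Lemma poly_act_inj (s : 'S_5) : injective (poly_act s).
Proof.
by apply: (can_inj (g := poly_act s^-1%g)) => f; rewrite -poly_actM mulgV poly_act1.
Qed.

(** Applying [t] permutes the orbit of [f]: the map is injective, and the preimage of [poly_act s f]
    is [poly_act (s * t^-1) f]. *)
Lemma invariant_o (f : coord_ring) : invariant (o f).
Proof.
move=> t; rewrite /o poly_act_sum -(big_map (poly_act t) xpredT id).
apply/perm_big/uniq_perm; rewrite ?(map_inj_uniq (@poly_act_inj t)) ?undup_uniq //.
move=> h; rewrite mem_undup; apply/mapP/imageP => [[h'] | [s _ ->]].
  rewrite mem_undup => /imageP[s _ ->] ->.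
  by exists (s * t)%g; rewrite ?poly_actM.
exists (poly_act (s * t^-1)%g f).
  by rewrite mem_undup; apply/imageP; exists (s * t^-1)%g.
by rewrite -poly_actM mulgKV.
Qed.

Lemma invariant_sum (I : eqType) (r : seq I) (F : I -> coord_ring) :
  {in r, forall i, invariant (F i)} -> invariant (\sum_(i <- r) F i).
Proof. by move=> invF s; rewrite poly_act_sum; apply: eq_big_seq => i /invF. Qed.

Lemma eval_act (s : 'S_5) (f : coord_ring) (u v : V) :
  (forall e, v (edge_act s e) = u e) -> eval (poly_act s f) v = eval f u.
Proof.
move=> vu; rewrite /eval /poly_act comp_mpoly_meval; apply: meval_eq => k.
by rewrite tnth_mktuple mevalXU enum_rankK vu.
Qed.

(** The hypothesis on [s] says that it is a graph isomorphism from [u] to [v]; isomorphism is used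
    in this form throughout. *)
Lemma eval_invariant (f : coord_ring) (s : 'S_5) (u v : V) :
  invariant f -> (forall e, v (edge_act s e) = u e) -> eval f v = eval f u.
Proof. by move=> invf /(eval_act f) <-; rewrite invf. Qed.

Lemma eval_sum (I : Type) (r : seq I) (F : I -> coord_ring) (v : V) :
  eval (\sum_(i <- r) F i) v = \sum_(i <- r) eval (F i) v.
Proof. exact: raddf_sum. Qed.

Lemma eval_prod (I : Type) (r : seq I) (F : I -> coord_ring) (v : V) :
  eval (\prod_(i <- r) F i) v = \prod_(i <- r) eval (F i) v.
Proof. exact: rmorph_prod. Qed.

Lemma eval_evar (e : edge) (v : V) : eval (evar e) v = v e.
Proof. by rewrite /eval mevalXU enum_rankK. Qed.

(** * Computable encoding of edges, permutations and graphs *)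

(* For computations the edge with index [k] in [edges] is encoded by [k], and
   an edge set, whether a graph or a squarefree monomial, by a list of indices. *)
Definition edges : seq edge :=
  [:: @mk_edge v1 v2 isT; @mk_edge v1 v3 isT; @mk_edge v1 v4 isT;
      @mk_edge v1 v5 isT; @mk_edge v2 v3 isT; @mk_edge v2 v4 isT;
      @mk_edge v2 v5 isT; @mk_edge v3 v4 isT; @mk_edge v3 v5 isT;
      @mk_edge v4 v5 isT].

Definition edge_ends : seq (nat * nat) :=
  [:: (0, 1); (0, 2); (0, 3); (0, 4); (1, 2);
      (1, 3); (1, 4); (2, 3); (2, 4); (3, 4)]%N.

Definition edge_at (k : nat) : edge := nth (@mk_edge v1 v2 isT) edges k.

Definition edge_index (a b : nat) : nat :=
  index (if (a < b)%N then (a, b) else (b, a)) edge_ends.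

Lemma edge_indexP (a b : 'I_5) (neq_ab : a != b) :
  (edge_index a b < 10)%N /\ edge_at (edge_index a b) = mk_edge neq_ab.
Proof.
case: a b neq_ab => [[|[|[|[|[|//]]]]] ha] [[|[|[|[|[|//]]]]] hb] // neq_ab;
  split => //; apply/val_inj => /=;
  by [congr [set _; _]; apply/val_inj | rewrite [RHS]setUC; congr [set _; _]; apply/val_inj].
Qed.

Lemma uniq_edges : uniq edges.
Proof.
(* Each edge is replaced by its incidence vector, since lists of booleans can be compared by
   computation. *)
apply: (@map_uniq _ _
  (fun e : edge => [seq x \in val e | x <- [:: v1; v2; v3; v4; v5]])).
by rewrite /= !in_set2.
Qed.

Lemma edge_at_inj : {in gtn 10 &, injective edge_at}.
Proof.
move=> i j /= lti ltj /eqP; rewrite nth_uniq ?uniq_edges //.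
by move/eqP.
Qed.

Lemma edge_atP (e : edge) : exists2 k, (k < 10)%N & e = edge_at k.
Proof.
have /cards2P[a [b [neq_ab def_e]]] := valP e.
have [lt10 def_k] := edge_indexP neq_ab.
exists (edge_index a b) => //; rewrite def_k; exact/val_inj.
Qed.

(** Permutations become lists of images, so that orbits can be enumerated by [vm_compute]. *)
Definition perm_table (s : 'S_5) : seq nat :=
  [seq (s i : nat) | i <- [:: v1; v2; v3; v4; v5]].

Definition perm_tables : seq (seq nat) := permutations (iota 0 5).

Lemma perm_table_mem (s : 'S_5) : perm_table s \in perm_tables.
Proof.
rewrite mem_permutations; apply: uniq_perm => //.
  by rewrite map_inj_uniq // => i j /val_inj/perm_inj.
move=> k; rewrite mem_iota /=; apply/mapP/idP => [[i _ ->] // | ltk].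
have: (s^-1)%g (Ordinal ltk) \in [:: v1; v2; v3; v4; v5].
  by case: ((s^-1)%g _) => [[|[|[|[|[|//]]]]] h]; rewrite !inE.
by exists ((s^-1)%g (Ordinal ltk)); rewrite // permKV.
Qed.

Lemma perm_tableP (p : seq nat) :
  p \in perm_tables -> exists s : 'S_5, perm_table s = p.
Proof.
rewrite mem_permutations => eqp.
have sz_p: size p = 5 by rewrite (perm_size eqp).
have lt_p i : (i < 5)%N -> (nth 0 p i < 5)%N.
  move=> lti; have : nth 0%N p i \in p by rewrite mem_nth ?sz_p.
  by rewrite (perm_mem eqp) mem_iota.
have inj_f: injective (fun i : 'I_5 => Ordinal (lt_p i (ltn_ord i))).
  move=> i j /(congr1 val)/eqP /=; rewrite nth_uniq ?sz_p //.
    by move/eqP/val_inj.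
  by rewrite (perm_uniq eqp) iota_uniq.
exists (perm inj_f); rewrite /perm_table /= !permE /=.
by case: p sz_p {eqp lt_p inj_f} => [|? [|? [|? [|? [|? []]]]]].
Qed.

Definition edge_perm (p : seq nat) (k : nat) : nat :=
  let: (a, b) := nth (0, 0)%N edge_ends k in edge_index (nth 0 p a) (nth 0 p b).

Lemma edge_permP (s : 'S_5) (k : nat) : (k < 10)%N ->
  (edge_perm (perm_table s) k < 10)%N /\
  edge_act s (edge_at k) = edge_at (edge_perm (perm_table s) k).
Proof.
have act_edge x y (neq_xy : x != y) : (edge_index (s x) (s y) < 10)%N /\
    edge_act s (mk_edge neq_xy) = edge_at (edge_index (s x) (s y)).
  have neq_s : s x != s y by rewrite (inj_eq perm_inj).
  have [lt10 ->] := edge_indexP neq_s; split => //.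
  by apply/val_inj; rewrite /= imsetU1 imset_set1.
by move: k => [|[|[|[|[|[|[|[|[|[|k]]]]]]]]]] // _; apply: act_edge.
Qed.

(** The bound matters: from 10 on, [nth] returns the default loop (0, 0), whose image has index 10,
    so all such [k] are sent to 10. *)
Lemma edge_perm_inj (s : 'S_5) :
  {in gtn 10 &, injective (edge_perm (perm_table s))}.
Proof.
move=> i j /= lti ltj eq_ij; apply: edge_at_inj => //.
have: edge_act s (edge_at i) = edge_act s (edge_at j).
  by rewrite (edge_permP s lti).2 (edge_permP s ltj).2 eq_ij.
move/(congr1 val) => /= /(imset_inj perm_inj); exact: val_inj.
Qed.

(** Sorting gives each duplicate-free edge list a canonical form, so that edge sets can be compared
    as lists. *)
Definition move_edges (p E : seq nat) : seq nat := sort leq (map (edge_perm p) E).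

Definition graph (E : seq nat) : V := [ffun e => (index e edges \in E)%:R].

Lemma graph_at (E : seq nat) (k : nat) :
  (k < 10)%N -> graph E (edge_at k) = (k \in E)%:R.
Proof. by move=> ltk; rewrite ffunE index_uniq ?uniq_edges. Qed.

Lemma graph_nil (e : edge) : graph [::] e = 0.
Proof. by rewrite ffunE. Qed.

Lemma eq_graph (E F : seq nat) : E =i F -> graph E = graph F.
Proof. by move=> eqEF; apply/ffunP => e; rewrite !ffunE eqEF. Qed.

Lemma mem_map_edge_perm (s : 'S_5) (E : seq nat) (k : nat) :
    all (gtn 10) E -> (k < 10)%N ->
  (edge_perm (perm_table s) k \in map (edge_perm (perm_table s)) E) = (k \in E).
Proof.
move=> /allP ltE ltk; apply/mapP/idP => [[j jE] | kE]; last by exists k.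
by move/edge_perm_inj => ->; rewrite // ?inE; apply: ltE.
Qed.

Lemma graph_move (s : 'S_5) (E : seq nat) (e : edge) : all (gtn 10) E ->
  graph (move_edges (perm_table s) E) (edge_act s e) = graph E e.
Proof.
move=> ltE; have [k ltk ->] := edge_atP e.
have [lt10 ->] := edge_permP s ltk.
by rewrite !graph_at // mem_sort mem_map_edge_perm.
Qed.

Lemma F2_bool (x : 'F_2) : x = (x != 0)%:R.
Proof. by case: x => [[|[|//]] h]; apply/val_inj. Qed.

Lemma F2_odd (n : nat) : n%:R = (odd n)%:R :> 'F_2.
Proof.
elim: n => //= n IH; rewrite -natr1 IH; case: (odd n) => /=; exact/val_inj.
Qed.

Lemma graph_surj (v : V) : exists2 E, all (gtn 10) E & v = graph E.
Proof.
exists [seq k <- iota 0 10 | v (edge_at k) != 0].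
  by apply/allP => k; rewrite mem_filter mem_iota => /andP[].
apply/ffunP => e; have [k ltk ->] := edge_atP e.
by rewrite graph_at // mem_filter mem_iota leq0n ltk !andbT; apply: F2_bool.
Qed.

(** * Isomorphism classes of graphs on five vertices *)

(* The lexicographically least edge list in each isomorphism class. *)
Definition graph_reps : seq (seq nat) :=
  [:: [::];
   [:: 0];
   [:: 0; 1];
   [:: 0; 7];
   [:: 0; 1; 2];
   [:: 0; 1; 4];
   [:: 0; 1; 5];
   [:: 0; 1; 9];
   [:: 0; 1; 2; 3];
   [:: 0; 1; 2; 4];
   [:: 0; 1; 2; 6];
   [:: 0; 1; 4; 9];
   [:: 0; 1; 5; 7];
   [:: 0; 1; 5; 8];
   [:: 0; 1; 2; 3; 4];
   [:: 0; 1; 2; 4; 5];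
   [:: 0; 1; 2; 4; 6];
   [:: 0; 1; 2; 4; 9];
   [:: 0; 1; 2; 6; 8];
   [:: 0; 1; 5; 8; 9];
   [:: 0; 1; 2; 3; 4; 5];
   [:: 0; 1; 2; 3; 4; 9];
   [:: 0; 1; 2; 4; 5; 7];
   [:: 0; 1; 2; 4; 5; 8];
   [:: 0; 1; 2; 4; 6; 9];
   [:: 0; 1; 2; 6; 8; 9];
   [:: 0; 1; 2; 3; 4; 5; 6];
   [:: 0; 1; 2; 3; 4; 5; 7];
   [:: 0; 1; 2; 3; 4; 5; 8];
   [:: 0; 1; 2; 4; 5; 8; 9];
   [:: 0; 1; 2; 3; 4; 5; 6; 7];
   [:: 0; 1; 2; 3; 4; 5; 8; 9];
   [:: 0; 1; 2; 3; 4; 5; 6; 7; 8];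
   [:: 0; 1; 2; 3; 4; 5; 6; 7; 8; 9]]%N.

Lemma graph_reps_lt10 : all (all (gtn 10)) graph_reps.
Proof. by []. Qed.

(* Starting from the empty graph, this yields completeness of the list. *)
Lemma graph_reps_add_edge :
  all (fun r => all (fun k => (k \in r) ||
         has (fun p => move_edges p (k :: r) \in graph_reps) perm_tables)
       (iota 0 10)) graph_reps.
Proof. by vm_compute. Qed.

(** Induction on the edge list. An isomorphism [s] from [E] to a representative [r] carries the
    added edge [k] to [k'], and [graph_reps_add_edge] supplies a further permutation [t] taking
    [k' :: r] to a listed graph. *)
Lemma graph_reps_complete (v : V) :
  exists2 r, r \in graph_reps &
    exists s : 'S_5, forall e, graph r (edge_act s e) = v e.
Proof.
have [E ltE ->] := graph_surj v; elim: E ltE => [_ | k E IH /andP[ltk ltE]].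
  exists [::]; first exact: mem_head.
  by exists 1%g => e; rewrite !graph_nil.
have [r r_rep [s rs]] := IH ltE; have [ltk' def_k] := edge_permP s ltk.
set k' := edge_perm _ k in ltk' def_k.
have ks e : graph (k' :: r) (edge_act s e) = graph (k :: E) e.
  have [j ltj def_e] := edge_atP e; have [ltj' def_j] := edge_permP s ltj.
  have := rs e; rewrite def_e def_j !graph_at // !inE => rs_j.
  rewrite (inj_in_eq (@edge_perm_inj s)) //.
  by case: (j == k).
have /allP/(_ r r_rep)/allP/(_ k') := graph_reps_add_edge.
rewrite mem_iota => /(_ ltk')/orP[k'r | /hasP[p /perm_tableP[t <-]] rep'].
  (* The list [E] may repeat edges, so the added edge can already be present. *)
  exists r => //; exists s => e; rewrite -ks; congr (fun_of_fin _ _).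
  by apply: eq_graph => j; rewrite inE; case: eqP => // ->.
exists (move_edges (perm_table t) (k' :: r)) => //.
exists (s * t)%g => e; rewrite edge_actM graph_move ?ks //= ltk'.
exact: (allP graph_reps_lt10).
Qed.

(** * Squarefree monomials and their orbit sums *)

Definition monom (E : seq nat) : coord_ring := \prod_(k <- E) evar (edge_at k).

Definition monom_orbit (E : seq nat) : seq (seq nat) :=
  undup [seq move_edges p E | p <- perm_tables].

Lemma poly_act_monom (s : 'S_5) (E : seq nat) : all (gtn 10) E ->
  poly_act s (monom E) = monom (move_edges (perm_table s) E).
Proof.
move=> ltE; rewrite poly_act_prod /monom (perm_big _ (permEl (perm_sort _ _))) big_map.
apply: eq_big_seq => k /(allP ltE) /= ltk.
by rewrite poly_act_evar (edge_permP s ltk).2.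
Qed.

Lemma eval_monom (E G : seq nat) :
  all (gtn 10) E -> eval (monom E) (graph G) = (all (mem G) E)%:R.
Proof.
rewrite eval_prod; elim: E => [|k E IH /andP[ltk ltE]]; first by rewrite big_nil.
rewrite big_cons IH // eval_evar graph_at //=.
by rewrite -natrM mulnb.
Qed.

(** The monomial of [E] is nonzero at the graph [F] exactly when [E] is contained in [F]. Equal
    monomials thus have equal edge sets, and a strictly sorted list is determined by its set of
    entries. *)
Lemma monom_inj :
  {in [pred E | all (gtn 10) E && sorted ltn E] &, injective monom}.
Proof.
have sub E F : all (gtn 10) E -> all (gtn 10) F -> monom E = monom F ->
    {subset E <= F}.
  move=> ltE ltF eqEF k kE.
  have := eval_monom F ltE; rewrite eqEF eval_monom //.
  have -> : all (mem F) F by apply/allP.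
  by case: allP => // EF _; apply: EF.
move=> E F /andP[ltE srtE] /andP[ltF srtF] eqEF.
apply: (irr_sorted_eq ltn_trans ltnn srtE srtF) => k.
by apply/idP/idP; apply: sub.
Qed.

(** A decidable condition placing the orbit where [monom] is injective, so that removing duplicate
    lists amounts to removing duplicate polynomials in [o]. *)
Definition orbit_wf (E : seq nat) : bool := all (gtn 10) E &&
  all (fun F => all (gtn 10) F && sorted ltn F) (monom_orbit E).

Lemma o_monom (E : seq nat) :
  orbit_wf E -> o (monom E) = \sum_(F <- monom_orbit E) monom F.
Proof.
case/andP=> ltE /allP wfE; rewrite /o -(big_map monom xpredT id).
apply/perm_big/uniq_perm; rewrite ?undup_uniq //.
  rewrite map_inj_in_uniq ?undup_uniq // => F G /wfE wfF /wfE wfG.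
  exact: monom_inj.
move=> h; rewrite mem_undup; apply/imageP/mapP => [[s _ ->] | [F]].
  exists (move_edges (perm_table s) E); last exact: poly_act_monom.
  rewrite mem_undup; apply/mapP.
  by exists (perm_table s); rewrite ?perm_table_mem.
rewrite mem_undup => /mapP[p /perm_tableP[s <-] ->] ->.
by exists s; rewrite // poly_act_monom.
Qed.

Lemma eval_o_monom (E G : seq nat) : orbit_wf E ->
  eval (o (monom E)) (graph G) = (odd (count (all (mem G)) (monom_orbit E)))%:R.
Proof.
move=> wfE; rewrite o_monom // eval_sum -F2_odd -sum1_count natr_sum [RHS]big_mkcond.
have /andP[_ /allP wf] := wfE.
apply: eq_big_seq => F /wf/andP[ltF _]; rewrite eval_monom //.
by case: (all _ F).
Qed.

Lemma evar_homog (e : edge) : evar e \is 1.-homog.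
Proof. by rewrite dhomogX /= mdeg1. Qed.

Lemma monom_homog (E : seq nat) : monom E \is (size E).-homog.
Proof.
rewrite /monom; elim: E => [|k E IH]; first by rewrite big_nil dhomog1.
by rewrite big_cons; apply: (@dhomogM _ _ _ 1 _ (size E)); rewrite ?evar_homog.
Qed.

Lemma o_monom_homog (E : seq nat) : orbit_wf E -> o (monom E) \is (size E).-homog.
Proof.
case/andP=> ltE _; rewrite /o big_seq; apply: rpred_sum => h.
rewrite mem_undup => /imageP[s _ ->]; rewrite poly_act_monom //.
have -> : size E = size (move_edges (perm_table s) E) by rewrite size_sort size_map.
exact: monom_homog.
Qed.

(** * The six invariants separate the classes *)

(** In order, the graphs are: an edge; a path with two edges; two disjoint edges; the star with
    three edges; the triangle; the star with four edges. The added summands are the 4-cycle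
    [[:: 0; 1; 5; 7]] and, in the last entry, the complete bipartite graph with parts of sizes 3 and
    2. *)
Definition g_shapes : seq (seq (seq nat)) :=
  [:: [:: [:: 0]];
      [:: [:: 0; 1]];
      [:: [:: 0; 7]; [:: 0; 1; 5; 7]];
      [:: [:: 0; 1; 2]; [:: 0; 1; 5; 7]];
      [:: [:: 0; 1; 4]; [:: 0; 1; 5; 7]];
      [:: [:: 0; 1; 2; 3]; [:: 2; 3; 5; 6; 7; 8]]]%N.

Definition shape_poly (L : seq (seq nat)) : coord_ring :=
  \sum_(E <- L) o (monom E).

Lemma shape_poly1 (E : seq nat) : shape_poly [:: E] = o (monom E).
Proof. exact: big_seq1. Qed.

Lemma shape_poly2 (E F : seq nat) :
  shape_poly [:: E; F] = o (monom E) + o (monom F).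
Proof. by rewrite /shape_poly big_cons big_seq1. Qed.

Lemma monom1 (k : nat) : monom [:: k] = evar (edge_at k).
Proof. exact: big_seq1. Qed.

Lemma monom_cons (k : nat) (E : seq nat) :
  monom (k :: E) = evar (edge_at k) * monom E.
Proof. exact: big_cons. Qed.

Lemma g_shapesE : [:: g1; g2; g3; g4; g5; g6] = map shape_poly g_shapes.
Proof.
rewrite /g_shapes !map_cons !shape_poly2 !shape_poly1.
(* Products are reassociated to the right to match [monom_cons]; the edges then agree by
   conversion. *)
rewrite !(monom1, monom_cons) /g1 /g2 /g3 /g4 /g5 /g6 -!mulrA.
exact: erefl.
Qed.

Lemma g_shapes_wf : all (all orbit_wf) g_shapes.
Proof. by vm_compute. Qed.

Lemma shape_poly_invariant (L : seq (seq nat)) : invariant (shape_poly L).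
Proof. by apply: invariant_sum => E _; apply: invariant_o. Qed.

Definition signature (Os : seq (seq (seq (seq nat)))) (G : seq nat) : seq bool :=
  [seq odd (sumn [seq count (all (mem G)) orb | orb <- orbs]) | orbs <- Os].

Definition g_orbits := [seq map monom_orbit L | L <- g_shapes].

Lemma eval_g (G : seq nat) :
  [seq eval (shape_poly L) (graph G) | L <- g_shapes] =
  [seq (b : nat)%:R | b : bool <- signature g_orbits G].
Proof.
rewrite /signature /g_orbits -!map_comp; apply/eq_in_map => L L_g /=.
rewrite -F2_odd sumnE !big_map natr_sum eval_sum.
apply: eq_big_seq => E EL; rewrite -?map_comp eval_o_monom -?F2_odd //.
exact: allP (allP g_shapes_wf L L_g) _ EL.
Qed.

(** This finite check on 34 parity vectors is what makes the six polynomials tell the classes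
    apart. *)
Lemma signature_uniq : uniq (map (signature g_orbits) graph_reps).
Proof. by vm_compute. Qed.

Lemma g_separate_reps (r r' : seq nat) :
    r \in graph_reps -> r' \in graph_reps ->
    {in g_shapes, forall L,
      eval (shape_poly L) (graph r) = eval (shape_poly L) (graph r')} ->
  r = r'.
Proof.
move=> rr rr' eq_g.
suff: signature g_orbits r = signature g_orbits r'.
  have [[i lti <-] [j ltj <-]] := (nthP [::] rr, nthP [::] rr').
  move/eqP; rewrite -!(nth_map [::] [::] (signature g_orbits)) //.
  by rewrite nth_uniq ?size_map ?signature_uniq // => /eqP ->.
apply: (@inj_map _ _ (fun b : bool => (b : nat)%:R : 'F_2)).
  by move=> [] [] // /(congr1 val).
rewrite -!eval_g; exact/eq_in_map.
Qed.

Lemma g_separate (u v : V) :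
    {in g_shapes, forall L, eval (shape_poly L) u = eval (shape_poly L) v} ->
  forall f, invariant f -> eval f u = eval f v.
Proof.
have [r rr [s rs]] := graph_reps_complete u.
have [r' rr' [s' rs']] := graph_reps_complete v.
move=> eq_g; suff eq_r : r = r'.
  move=> f invf; rewrite -(eval_invariant invf rs) eq_r.
  exact: eval_invariant rs'.
apply: g_separate_reps => // L L_g.
have inv_L := @shape_poly_invariant L.
by rewrite (eval_invariant inv_L rs) (eval_invariant inv_L rs') eq_g.
Qed.

Lemma g_separating : separating (fun f => f \in map shape_poly g_shapes).
Proof.
split=> [f /mapP[L _ ->] | u v [f invf neq_f]]; first exact: shape_poly_invariant.
have [eq_g | ] := altP (@allP _ (fun L => eval (shape_poly L) u == eval (shape_poly L) v) g_shapes).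
  by case: neq_f; apply: g_separate => // L /eq_g/eqP.
by case/allPn => L L_g /eqP neq; exists (shape_poly L); rewrite ?map_f.
Qed.

(** Some of the six polynomials mix degrees, but if a sum of orbit sums differs at [u] and [v], so
    does one of its homogeneous summands. *)
Lemma homog_invariants6_separating : separating (homog_invariants_upto 6).
Proof.
split=> [f [] // | u v /(g_separating.2)[_ /mapP[L L_g ->]]].
rewrite !eval_sum => neq.
have [eq_L | ] := altP (@allP _ (fun E => eval (o (monom E)) u == eval (o (monom E)) v) L).
  by case: neq; apply: eq_big_seq => E /eq_L/eqP.
case/allPn => E EL /eqP neqE; exists (o (monom E)) => //.
split; first exact: invariant_o.
have wfE := allP (allP g_shapes_wf L L_g) _ EL.
exists (size E); last exact: o_monom_homog.
have: all (all (fun E => size E <= 6)%N) g_shapes by [].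
by move/allP/(_ L L_g)/allP; apply.
Qed.

(** * Minimality of the size, and the degree bound *)

Lemma separating_size (s : seq coord_ring) :
  separating (fun f => f \in s) -> (6 <= size s)%N.
Proof.
case=> inv_s sep_s; rewrite leqNgt; apply/negP => small.
pose values r := map_tuple (fun f => eval f (graph r)) (in_tuple s).
have values_inj : {in graph_reps &, injective values}.
  move=> r r' rr rr' eq_v; apply: g_separate_reps => // L L_g.
  apply/eqP/negPn/negP => /eqP neqL.
  (* A [shape_poly] that differs on the two representatives is invariant, so some member of [s] must
     differ on them too, against the equality of value tuples. *)
  have [|f fs] := sep_s (graph r) (graph r').
    by exists (shape_poly L) => //; apply: shape_poly_invariant.
  by case; have /(congr1 val)/eq_in_map/(_ f fs) := eq_v.
have /uniq_leq_size/(_ (fun x _ => mem_enum _ x)) : uniq (map values graph_reps).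
  by rewrite map_inj_in_uniq.
rewrite size_map -cardE card_tuple card_ord leqNgt => /negP; apply.
by apply: (@leq_ltn_trans (2 ^ 5)); rewrite // leq_exp2l.
Qed.

(** Being separating is not a decidable predicate here, so the least degree is obtained by excluded
    middle. *)
Lemma ex_least (P : nat -> Prop) (n : nat) : P n ->
  exists2 b, P b /\ (forall b', P b' -> (b <= b')%N) & (b <= n)%N.
Proof.
elim/ltn_ind: n => n IH Pn.
case: (classic (exists2 m, P m & (m < n)%N)) => [[m Pm ltmn] | least_n].
  by have [b Pb lebm] := IH m ltmn Pm; exists b; rewrite // (leq_trans lebm) 1?ltnW.
exists n => //; split=> // b' Pb'; rewrite leqNgt; apply/negP => ltb'.
by apply: least_n; exists b'.
Qed.

Theorem theorem3p2 :
  let gs : seq coord_ring := [:: g1; g2; g3; g4; g5; g6] in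
  [/\ separating (fun f => f \in gs),
      uniq gs,
      (forall s : seq coord_ring,
         separating (fun f => f \in s) -> (size gs <= size s)%N)
    & exists2 b : nat, is_beta_sep b & (b <= 6)%N].
Proof.
move=> gs; have gsE : gs = map shape_poly g_shapes := g_shapesE.
have gs_sep : separating (fun f => f \in gs) by rewrite gsE; apply: g_separating.
split=> //.
(* Distinctness follows from the lower bound: with a repetition, [undup gs] would be a separating
   list of fewer than six elements. *)
- rewrite -[uniq gs]negbK; apply/negP => dup.
  have sep_undup : separating (fun f => f \in undup gs).
    case: gs_sep => inv_gs sep_gs; split=> [f | u v /sep_gs[f]].
      by rewrite mem_undup; apply: inv_gs.
    by exists f; rewrite ?mem_undup.
  by have := separating_size sep_undup; rewrite leqNgt (@ltn_size_undup _ gs) dup.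
- by move=> s /separating_size.
- exact: ex_least homog_invariants6_separating.
Qed.
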